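(* For any partition $\lambda$, $r(B_{\bar\lambda})=|C_\lambda|+1$, where $C_\lambda$ is the canonical antidiagonal of $\lambda$, $\bar\lambda$ is the thickening of $\lambda$, $B_{\bar\lambda}$ is the bipartite graph of $\bar\lambda$, and $r(\cdot)$ denotes recession connectivity.
   Context: The diagram of a partition $\lambda=(\lambda_1\ge\lambda_2\ge\cdots)$ is the set of boxes $(i,j)$ with $1\le j\le\lambda_i$ (row $i$, column $j$). The canonical antidiagonal of $\lambda$ is the antidiagonal sequence $C_\lambda=\{e_1,\dots,e_k\}$ of maximum length contained in the diagram of $\lambda$ with $e_i=(k-i+1,i)$ for each $i$. Thus $|C_\lambda|$ is the largest $k$ such that $(k-i+1,i)\in\lambda$ for all $1\le i\le k$. If $\lambda$ has $\ell$ (nonzero) rows, its thickening is the partition $\bar\lambda$ with $\ell+1$ rows given by $\bar\lambda_1=\lambda_1+1$ and $\bar\lambda_i=\lambda_{i-1}+1$ for $1<i\le\ell+1$. The graph of a partition $\mu$ with $m$ rows and $n$ columns is the connected bipartite graph $B_\mu\subseteq K_{m,n}$ with vertex set $[m]\sqcup[n]$ (rows and columns) and an edge between row $i$ and column $j$ exactly when $(i,j)$ lies in the diagram of $\mu$. Let $B\subseteq K_{m,n}$ be a bipartite graph and $S$ a subgraph. The recession graph $R(S;B)$ is the directed bipartite graph built from $B$ (on all vertices of $B$) by directing the edges of $B\setminus S$ from $[m]$ to $[n]$ and making the edges of $S$ bidirectional. The recession connectivity $r(B)$ is the maximum number of connected components of a subgraph $S\subseteq B$ such that $R(S;B)$ is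 strongly connected. *)

(* Defs.v *)
From mathcomp Require Import all_boot.

Set Implicit Arguments.
Unset Strict Implicit.
Unset Printing Implicit Defensive.

(* A partition is the list of its nonzero parts; the empty list is the empty  *)
(* partition.                                                                 *)
Definition is_part (lam : seq nat) : bool := sorted geq lam && (0 \notin lam).

(* Boxes are numbered from 1: [lam]_i is [nth 0 lam i.-1].                     *)
Definition diagram (lam : seq nat) : pred (nat * nat) :=
  fun b => (0 < b.1) && (0 < b.2 <= nth 0 lam b.1.-1).

Definition antidiagonal (k : nat) : seq (nat * nat) :=
  [seq (k - i + 1, i) | i <- iota 1 k].

Lemma antidiagonal_bound (lam : seq nat) (k : nat) :
  all (diagram lam) (antidiagonal k) -> k <= size lam.
Proof.
case: k => // k /allP /(_ (k.+1, 1)).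
rewrite /diagram /=; case: (ltnP k (size lam)) => // le_lam_k.
rewrite (nth_default _ le_lam_k); apply.
by apply/mapP; exists 1; rewrite ?mem_iota // subn1 addn1.
Qed.

(* The bound on [k] loses nothing, by [antidiagonal_bound].                    *)
Definition canonical_antidiagonal (lam : seq nat) : seq (nat * nat) :=
  antidiagonal
    (\max_(k < (size lam).+1 | all (diagram lam) (antidiagonal k)) k).

Definition thickening (lam : seq nat) : seq nat :=
  (head 0 lam).+1 :: [seq p.+1 | p <- lam].

Lemma thickening_is_part (lam : seq nat) :
  is_part lam -> is_part (thickening lam).
Proof.
case/andP=> lam_sorted _; apply/andP; split; last first.
  by rewrite inE /=; apply/negP => /mapP[].
case: lam lam_sorted => //= p lam lam_sorted.
by rewrite /= leqnn /= path_map.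
Qed.

(* A bipartite graph B in K_(m, n), with vertex set [m] + [n], is its set of   *)
(* edges.                                                                      *)
Definition bigraph (m n : nat) : finType := {set 'I_m * 'I_n}.

Definition partition_graph (mu : seq nat) : bigraph (size mu) (head 0 mu) :=
  [set e : 'I_(size mu) * 'I_(head 0 mu) | diagram mu (e.1.+1, e.2.+1)].

(* A subgraph has its own set of vertices and set of edges; it need not span.  *)
Definition subgraph_data (m n : nat) : finType :=
  ({set 'I_m + 'I_n} * {set 'I_m * 'I_n})%type.

Definition is_subgraph m n (S : subgraph_data m n) (B : bigraph m n) : bool :=
  (S.2 \subset B) &&
  [forall e in S.2, (inl e.1 \in S.1) && (inr e.2 \in S.1)].

Definition adjacency m n (E : {set 'I_m * 'I_n}) : rel ('I_m + 'I_n) :=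
  fun u v =>
    match u, v with
    | inl i, inr j | inr j, inl i => (i, j) \in E
    | _, _ => false
    end.

Definition num_components m n (S : subgraph_data m n) : nat :=
  n_comp (adjacency S.2) S.1.

Definition recession_graph m n (S : subgraph_data m n) (B : bigraph m n) :
    rel ('I_m + 'I_n) :=
  fun u v =>
    match u, v with
    | inl i, inr j => (i, j) \in B
    | inr j, inl i => (i, j) \in S.2
    | _, _ => false
    end.

Definition strongly_connected (V : finType) (R : rel V) : bool :=
  [forall u, forall v, connect R u v].

Definition recession_connectivity m n (B : bigraph m n) : nat :=
  \max_(S : subgraph_data m n |
        is_subgraph S B && strongly_connected (recession_graph S B))
    num_components S.

(* [n_comp] counts components when the relation is symmetric and the vertex    *)
(* set is closed under it.                                                     *)
Lemma adjacency_sym m n (E : {set 'I_m * 'I_n}) : symmetric (adjacency E).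
Proof. by move=> [i|j] [i'|j']. Qed.

Lemma subgraph_closed m n (S : subgraph_data m n) (B : bigraph m n) :
  is_subgraph S B -> closed (adjacency S.2) S.1.
Proof.
case/andP=> _ /forall_inP SV [i|j] [i'|j'] //= /SV /andP[] /=.
  by move=> -> ->.
by move=> -> ->.
Qed.

(* Main.v *)
Require Import Defs.
From mathcomp Require Import all_boot.
From mathcomp Require Import zify.

Set Implicit Arguments.
Unset Strict Implicit.
Unset Printing Implicit Defensive.

(** Upper bound: let [S] have [c] components and let [p + q = c] with
[p, q > 0]. If no edge of [B] joined a row of index at least [p] to a column
of index at least [q], every component would contain one of the first [p] rows
or one of the first [q] columns; there are at most [p + q] such vertices, so no
component would contain both kinds. The components of the first [q] columns
would then have no arrow to the others, against strong connectivity. Hence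
every box of the antidiagonal [p + q = c] lies in the diagram.

Lower bound: for an antidiagonal of length [k] in [lam], match the rows and
columns along its shift in the thickening, and put all other vertices in one
more component through the corner box. Row 0 points to every column and every
row points to column 0, so this is strongly connected. *)

Lemma connect_closed (V : finType) (e : rel V) (P : pred V) u v :
  (forall x y, P x -> e x y -> P y) -> connect e u v -> P u -> P v.
Proof.
move=> Pe /connectP[s]; elim: s u => [|w s IHs] u /=; first by move=> _ ->.
by case/andP=> euw /IHs{}IHs /IHs{}IHs /Pe/(_ euw).
Qed.

Lemma connect_in_edge (V : finType) (e : rel V) u v :
  connect e u v -> u != v -> exists w, e w v.
Proof.
case/connectP=> s; case/lastP: s => [_ -> /=|s x]; first by rewrite eqxx.
by rewrite rcons_path last_rcons => /andP[_ ex] -> _; exists (last u s).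
Qed.

Lemma connect_out_edge (V : finType) (e : rel V) u v :
  connect e u v -> u != v -> exists w, e u w.
Proof.
case/connectP=> [[_ -> /=|w s]]; first by rewrite eqxx.
by case/andP=> euw _ _ _; exists w.
Qed.

Lemma adjacency_connect_sym m n (E : {set 'I_m * 'I_n}) :
  connect_sym (adjacency E).
Proof. exact/sym_connect_sym/adjacency_sym. Qed.

Lemma card_ord_lt n p : #|[set i : 'I_n | i < p]| <= p.
Proof.
rewrite cardE -(size_map val) -[leqRHS](size_iota 0); apply: uniq_leq_size.
  by rewrite (map_inj_uniq val_inj) enum_uniq.
by move=> _ /mapP[i + ->]; rewrite mem_enum inE mem_iota.
Qed.

(** Indices start at 0, so [e] is a box weakly beyond [(p + 1, q + 1)]. In a thickening this
    corresponds to a box weakly beyond [(p, q)] of the original partition. *)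
Lemma strongly_connected_far_edge m n (B : bigraph m.+1 n.+1)
    (S : subgraph_data m.+1 n.+1) p q :
  is_subgraph S B -> strongly_connected (recession_graph S B) ->
  0 < p -> 0 < q -> p + q <= num_components S ->
  exists2 e, e \in B & (p <= e.1) && (q <= e.2).
Proof.
case/andP=> /subsetP sSB _ /forallP scS p0 q0 cS.
have {}scS u v : connect (recession_graph S B) u v by apply/forallP.
apply/exists_inP; apply: contraT => /exists_inPn noB.
have near i j : (i, j) \in B -> (i < p) || (j < q).
  by move/noB; rewrite negb_and -!ltnNge.
pose rt := root (adjacency S.2).
have rtE i j : (i, j) \in S.2 -> rt (inl i) = rt (inr j).
  by move=> ij; apply/(rootP (adjacency_connect_sym _))/connect1.
pose X := [set rt (inl i) | i in [set i : 'I_m.+1 | i < p]].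
pose Y := [set rt (inr j) | j in [set j : 'I_n.+1 | j < q]].
have inX (i : 'I_m.+1) : i < p -> rt (inl i) \in X by move=> ip; apply: imset_f; rewrite inE.
have inY (j : 'I_n.+1) : j < q -> rt (inr j) \in Y by move=> jq; apply: imset_f; rewrite inE.
have edgeXY i j : (i, j) \in S.2 -> rt (inl i) \in X :|: Y.
  move=> ij; rewrite inE; case/orP: (near _ _ (sSB _ ij)) => [/inX-> //|/inY].
  by rewrite (rtE _ _ ij) orbC => ->.
(* No vertex is isolated in [S]: a row can only be entered, and a column only left, along an edge of
   [S]. *)
have rtXY v : rt v \in X :|: Y.
  case: v => [i|j].
    have [//|[i'|j] //= ij] := connect_in_edge (scS (inr ord0) (inl i)).
    exact: edgeXY ij.
  have [//|[i|j'] //= ij] := connect_out_edge (scS (inr j) (inl ord0)).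
  by rewrite -(rtE _ _ ij); apply: edgeXY ij.
have cXY : p + q <= #|X :|: Y|.
  apply: leq_trans cS _; apply/subset_leq_card/subsetP => v.
  by rewrite !inE => /andP[/eqP <- _]; have := rtXY v; rewrite inE.
have disXY : X :&: Y = set0.
  apply/eqP; rewrite -cards_eq0.
  have cX : #|X| <= p := leq_trans (leq_imset_card _ _) (card_ord_lt _ _).
  have cY : #|Y| <= q := leq_trans (leq_imset_card _ _) (card_ord_lt _ _).
  by have := cardsUI X Y; lia.
(* Row 0 lies in [X] since [0 < p]. Following a path from column 0 to row 0 shows that it also lies
   in [Y]: arrows out of columns stay in their component, and an arrow out of a row of [Y] ends in
   one of the first [q] columns, as its row cannot be among the first [p]. *)
suff : rt (inl ord0) \in X :&: Y by rewrite disXY inE.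
rewrite inE inX //=.
pose P v := rt v \in Y.
apply: (connect_closed (P := P)) (scS (inr ord0) _) (inY _ _) => //.
rewrite /P => -[i|j] [i'|j'] //= rtY; last by move/rtE->.
move/near/orP => [/inX iX|]; last exact: inY.
by have : rt (inl i) \in X :&: Y; [rewrite inE iX | rewrite disXY inE].
Qed.

Lemma leq_recession_connectivity_antidiagonal m n (B : bigraph m.+1 n.+1) k :
  k <= m -> k <= n ->
  (forall i, (i, ord0) \in B) -> (forall j, (ord0, j) \in B) ->
  (forall i j : nat, 0 < i -> 0 < j -> i + j = k.+1 ->
    (inord i, inord j) \in B) ->
  k < recession_connectivity B.
Proof.
move=> km kn Bcol Brow Bdiag.
pose E := [set e : 'I_m.+1 * 'I_n.+1 |
  [|| (e.1 == 0 :> nat) && ((e.2 == 0 :> nat) || (k < e.2)),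
      (e.2 == 0 :> nat) && (k < e.1) |
      [&& 0 < e.1, 0 < e.2 & e.1 + e.2 == k.+1]]].
pose S : subgraph_data m.+1 n.+1 := (setT, E).
have sSB : is_subgraph S B.
  apply/andP; split; last by apply/forall_inP => e _; rewrite !inE.
  apply/subsetP => -[i j]; rewrite inE /=.
  case/or3P => [/andP[/eqP i0 _]|/andP[/eqP j0 _]|/and3P[i0 j0 /eqP ij]].
  - by rewrite (_ : i = ord0) //; apply: val_inj.
  - by rewrite (_ : j = ord0) //; apply: val_inj.
  - by rewrite -(inord_val i) -(inord_val j) Bdiag.
have scS : strongly_connected (recession_graph S B).
  set R := recession_graph S B.
  have R00 : connect R (inr ord0) (inl ord0) by apply: connect1; rewrite /= inE.
  have row_out i : connect R (inl i) (inl ord0).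
    by apply: connect_trans R00; apply/connect1/Bcol.
  have col_in j : connect R (inl ord0) (inr j) by apply/connect1/Brow.
  apply/forallP => u; apply/forallP => v.
  apply: (@connect_trans _ _ (inl ord0)).
    case: u => [i|j]; first exact: row_out.
    (* The neighbour of column [j] in [S]: its partner in the matching, or row 0 if [j] is in the
       corner component. *)
    pose i : 'I_m.+1 := inord (if 0 < j <= k then k.+1 - j else 0).
    apply: connect_trans (row_out i); apply: connect1.
    by rewrite /= inE /= inordK; case: ifP; lia.
  case: v => [i|j]; last exact: col_in.
  pose j : 'I_n.+1 := inord (if 0 < i <= k then k.+1 - i else 0).
  have [-> //|i0] := eqVneq i ord0.
  apply: connect_trans (col_in j) _; apply: connect1.
  have {}i0 : i != 0 :> nat by [].
  by rewrite /= inE /= inordK; case: ifP; lia.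
apply: (@leq_trans (num_components S)); last first.
  by apply: leq_bigmax_cond; rewrite sSB.
(* An invariant of components: the row of the matching edge, or 0 for the corner component. It
   separates rows 0 to [k], giving [k + 1] components. *)
pose label (v : 'I_m.+1 + 'I_n.+1) :=
  match v with
  | inl i => if i <= k then i : nat else 0
  | inr j => if 0 < j <= k then k.+1 - j else 0
  end.
have labelE u v : connect (adjacency E) u v -> label u = label v.
  move=> uv; apply/eqP.
  apply: (connect_closed (P := fun w => label u == label w)) uv _ => // x y.
  have aux i j : (i, j) \in E -> label (inl i) = label (inr j).
    by rewrite inE /=; case: ifP; case: ifP; lia.
  by move=> /eqP->; case: x y => [i|j] [i'|j'] //= /aux /= ->.
pose f (t : 'I_k.+1) := root (adjacency E) (inl (widen_ord (km : k < m.+1) t)).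
have f_inj : injective f.
  move=> t t' /(rootP (adjacency_connect_sym _))/labelE /=.
  by rewrite !leq_ord => /val_inj.
rewrite -[k.+1]card_ord -(card_codom f_inj).
apply/subset_leq_card/subsetP => _ /codomP[t ->].
by rewrite !inE /= roots_root //; apply: adjacency_connect_sym.
Qed.

Lemma all_diagram_antidiagonalP lam k :
  reflect (forall p q, 0 < p -> 0 < q -> p + q = k.+1 -> diagram lam (p, q))
          (all (diagram lam) (antidiagonal k)).
Proof.
apply: (iffP allP) => [dk p q p0 q0 pq | dk _ /mapP[q + ->]].
  apply: dk; apply/mapP; exists q; first by rewrite mem_iota; lia.
  by congr pair; lia.
by rewrite mem_iota => qk; apply: dk; lia.
Qed.

Lemma diagram_sub lam p q p' q' : is_part lam ->
  0 < p' <= p -> 0 < q' <= q -> diagram lam (p, q) -> diagram lam (p', q').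
Proof.
case/andP=> slam _ pp qq /andP[/= p0 /andP[q0 qp]].
have plt : p.-1 < size lam.
  by rewrite ltnNge; apply/negP => le; move: qp; rewrite nth_default //; lia.
have le : nth 0 lam p.-1 <= nth 0 lam p'.-1.
  have geq_trans : transitive geq by move=> x y z /= yx xz; apply: leq_trans xz yx.
  by apply: (sorted_leq_nth geq_trans leqnn 0 slam); rewrite ?inE; lia.
by rewrite /diagram /=; lia.
Qed.

Lemma diagram_thickening lam p q :
  0 < p -> 0 < q -> diagram (thickening lam) (p.+1, q.+1) = diagram lam (p, q).
Proof.
case: p => // p _ q0; rewrite /diagram /= q0.
have [plt|ple] := ltnP p (size lam); first by rewrite (nth_map 0).
(* Below the last row both lengths default to 0, so neither box is present. *)
by rewrite !nth_default ?size_map //; lia.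
Qed.

Theorem theorem6p15 (lam : seq nat) (hlam : is_part lam) :
  recession_connectivity (partition_graph (thickening lam)) =
  size (canonical_antidiagonal lam) + 1.
Proof.
rewrite size_map size_iota addn1; set k := \max_(_ < _ | _) _.
apply/eqP; rewrite eqn_leq; apply/andP; split.
  apply/bigmax_leqP => S /andP[sSB scS].
  (* With [c + 1] components, the pairs [p + q = c + 1] run over an antidiagonal of length [c]. *)
  case Dc: (num_components S) => [//|c]; rewrite ltnS.
  have dc : all (diagram lam) (antidiagonal c).
    apply/all_diagram_antidiagonalP => p q p0 q0 pq.
    have pqc : p + q <= num_components S by rewrite Dc pq.
    have [[i j]] := strongly_connected_far_edge sSB scS p0 q0 pqc.
    rewrite inE /= => ij /andP[/= pi qj]; rewrite -diagram_thickening //.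
    by apply: diagram_sub ij => //; apply: thickening_is_part.
  have cle := antidiagonal_bound dc.
  exact: (@leq_bigmax_cond _ (fun i : 'I_(size lam).+1 => all _ (antidiagonal i))
    (fun i => i : nat) (Ordinal (cle : c < (size lam).+1))).
have dk : all (diagram lam) (antidiagonal k).
  (* The maximum is attained: the condition holds for the empty antidiagonal and passes to the
     larger of two lengths. *)
  rewrite /k; elim/big_ind: _ => // x y dx dy.
  by case: (leqP x y).
have kle := antidiagonal_bound dk.
(* The last box [(1, k)] of the antidiagonal bounds [k] by the first part. *)
have khd : k <= head 0 lam.
  case: (posnP k) => [-> //|k0].
  have /(_ 1 k isT k0) := all_diagram_antidiagonalP _ _ dk.
  by rewrite add1n => /(_ erefl); rewrite /diagram /= nth0 => /andP[].
apply: (@leq_recession_connectivity_antidiagonal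
  (size [seq x.+1 | x <- lam]) (head 0 lam)) => //.
- by rewrite size_map.
- move=> i; rewrite inE /diagram /=.
  by case: i => -[|i] //= ilt; rewrite (nth_map 0) // -(size_map succn).
- by move=> j; rewrite inE /diagram /=; apply: ltn_ord.
move=> i j i0 j0 ij; rewrite inE /= !inordK ?size_map; try lia.
by rewrite diagram_thickening //; apply: (all_diagram_antidiagonalP _ _ dk).
Qed.
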